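(* For every $n\ge 1$, the number of $n\times n$ alternating sign matrices whose SW key avoids both $312$ and $321$ is the Catalan number $C_n=\frac{1}{n+1}\binom{2n}{n}$.
   Context: An alternating sign matrix (ASM) of size $n$ is an $n\times n$ matrix with entries in $\{0,1,-1\}$ such that every row and every column sums to $1$ and the nonzero entries of each row and of each column alternate in sign. Position $(i,j)$ is the $i$-th row from the top and $j$-th column from the left. The permutation matrix of $\sigma=\sigma(1)\dots\sigma(n)$ has a $1$ in row $i$, column $\sigma(i)$ for each $i$. A permutation $\sigma$ contains $\pi=\pi(1)\dots\pi(k)$ if there are indices $i_1<\dots<i_k$ with $\sigma(i_a)<\sigma(i_b)$ iff $\pi(a)<\pi(b)$; otherwise $\sigma$ avoids $\pi$. SW key process: a $-1$ entry is removable if no other $-1$ entry lies weakly southwest of it (weakly below and weakly to the left). For a removable $-1$ at $(i,j)$, let $(i,j_0)$ be the nearest $1$ to its west in its row and $(i_0,j)$ the nearest $1$ below it in its column; its neighboring $1$s are the $1$ entries weakly southwest of it such that no other $1$ entry lies both weakly northeast of them and weakly southwest of the $-1$. Consider the $1$s at $(i,j_0)$, $(i_0,j)$ and the neighboring $1$s lying in the rectangle of rows $i..i_0$ and columns $j_0..j$. Replace the south-most of these $1$s by $0$; then moving east to west, for each subsequent one of these $1$s, in column $c$ say, place a new $1$ in the row of the previously replaced $1$ and column $c$, and replace the old $1$ in column $c$ by $0$; finally replace the $-1$ by $0$. Repeating until no $-1$ remains yields a permutation matrix, independent of the order of removals, called the SW key of $A$. *)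

(* Defs.v *)
From HB Require Import structures.
From mathcomp Require Import all_boot all_order all_algebra all_fingroup.

Set Implicit Arguments.
Unset Strict Implicit.
Unset Printing Implicit Defensive.

Import GRing.Theory.

(* The finite type {0, 1, -1} as a subtype of int, so that matrices over it
   form a finType while sums and signs are computed in int via \val. *)
Definition entry : finType := seq_sub [:: 0; 1; -1 : int]%R.

Definition entry0 : entry := @SeqSub _ [:: 0; 1; -1 : int]%R 0%R isT.
Definition entry1 : entry := @SeqSub _ [:: 0; 1; -1 : int]%R 1%R isT.

Definition int_mx n (A : 'M[entry]_n) : 'M[int]_n := map_mx \val A.

(* Two nonzero entries with only zeros between them have opposite signs. *)
Definition alternating n (v : 'I_n -> int) : bool :=
  [forall j : 'I_n, forall k : 'I_n,
     [&& j < k, v j != 0%R, v k != 0%R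
       & [forall l : 'I_n, (j < l < k) ==> (v l == 0%R)]]
     ==> (v k == - v j)%R].

Definition is_asm n (A : 'M[entry]_n) : bool :=
  [&& [forall i, (\sum_j int_mx A i j == 1)%R],
      [forall j, (\sum_i int_mx A i j == 1)%R],
      [forall i, alternating (fun j => int_mx A i j)]
    & [forall j, alternating (fun i => int_mx A i j)]].

(* Positions are pairs (row, column), rows numbered from the top. *)
Definition pos n : finType := ('I_n * 'I_n)%type.

Definition is_one n (A : 'M[entry]_n) (p : pos n) : bool :=
  int_mx A p.1 p.2 == 1%R.

Definition is_neg n (A : 'M[entry]_n) (p : pos n) : bool :=
  int_mx A p.1 p.2 == (- 1)%R.

(* q is weakly below and weakly to the left of p *)
Definition weakly_sw n (q p : pos n) : bool := (p.1 <= q.1) && (q.2 <= p.2).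

Definition removable n (A : 'M[entry]_n) (p : pos n) : bool :=
  is_neg A p && [forall q, (is_neg A q && weakly_sw q p) ==> (q == p)].

Definition nearest_west n (A : 'M[entry]_n) (p : pos n) (j0 : 'I_n) : bool :=
  [&& j0 < p.2, is_one A (p.1, j0)
    & [forall c : 'I_n, (j0 < c < p.2) ==> ~~ is_one A (p.1, c)]].

Definition nearest_south n (A : 'M[entry]_n) (p : pos n) (i0 : 'I_n) : bool :=
  [&& p.1 < i0, is_one A (i0, p.2)
    & [forall r : 'I_n, (p.1 < r < i0) ==> ~~ is_one A (r, p.2)]].

Definition neighboring n (A : 'M[entry]_n) (p q : pos n) : bool :=
  [&& is_one A q, weakly_sw q p
    & [forall z, [&& is_one A z, weakly_sw q z & weakly_sw z p] ==> (z == q)]].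

(* The 1s affected by the removal of the -1 at p, where (p.1, j0) and
   (i0, p.2) are the nearest 1s to its west and below it. *)
Definition moved n (A : 'M[entry]_n) (p : pos n) (i0 j0 : 'I_n) : {set pos n} :=
  [set q | [|| q == (p.1, j0), q == (i0, p.2)
             | [&& neighboring A p q, p.1 <= q.1 <= i0 & j0 <= q.2 <= p.2]]].

(* q comes right after p when the positions of M are listed from east to west *)
Definition next_west n (M : {set pos n}) (p q : pos n) : bool :=
  [&& p \in M, q \in M, q.2 < p.2
    & [forall z in M, ~~ (q.2 < z.2 < p.2)]].

(* For consecutive moved 1s p, q (q next to the west of p), a new 1 is placed
   in the row of p and the column of q. *)
Definition placed n (M : {set pos n}) (x : pos n) : bool :=
  [exists p, exists q, [&& next_west M p q, x.1 == p.1 & x.2 == q.2]].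

Definition sw_remove n (A : 'M[entry]_n) (p : pos n) (i0 j0 : 'I_n) :
    'M[entry]_n :=
  let M := moved A p i0 j0 in
  \matrix_(r, c)
    if placed M (r, c) then entry1
    else if ((r, c) \in M) || ((r, c) == p) then entry0
    else A r c.

Definition sw_step n : rel 'M[entry]_n := fun A B =>
  [exists p, exists i0, exists j0,
     [&& removable A p, nearest_south A p i0, nearest_west A p j0
       & B == sw_remove A p i0 j0]].

(* perm_mx s has its 1 of row i in column s i.  A permutation matrix has no
   -1, so the removal process has then ended. *)
Definition is_sw_key n (A : 'M[entry]_n) (s : 'S_n) : bool :=
  [exists K : 'M[entry]_n,
     connect (@sw_step n) A K && (int_mx K == perm_mx s)].

(* The pattern w is given in one-line notation. *)
Definition contains_pattern n (s : 'S_n) (w : seq nat) : bool :=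
  [exists f : {ffun 'I_(size w) -> 'I_n},
     [forall a : 'I_(size w), forall b : 'I_(size w), (a < b) ==> (f a < f b)] &&
     [forall a : 'I_(size w), forall b : 'I_(size w),
        (s (f a) < s (f b)) == (nth 0 w a < nth 0 w b)]].

Definition avoids n (s : 'S_n) (w : seq nat) : bool :=
  ~~ contains_pattern s w.

Definition catalan (n : nat) : nat := 'C(2 * n, n) %/ n.+1.

(* Main.v *)
Require Import Defs.
From mathcomp Require Import all_boot all_order all_algebra all_fingroup.
From mathcomp Require Import zify.

Set Implicit Arguments.
Unset Strict Implicit.
Unset Printing Implicit Defensive.

Import Order.TTheory GRing.Theory Num.Theory.

(* Let [corner A r c] be the sum of the entries of [A] in rows [>= r] and
   columns [< c].  A permutation avoids 312 and 321 iff every entry has at most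
   one smaller entry to its right, which for its matrix amounts to
   [corner <= 1] whenever [c <= r + 1].  Removing a -1 keeps the matrix an ASM
   and adds to [corner] the indicator of the staircase between the -1 and the
   moved 1s; hence the key satisfies the bound only if [A] does.  Conversely, if
   [A] satisfies it, then [corner] vanishes strictly southwest of every -1, so
   the bound survives each removal.  The ASMs with the bound have
   [corner A r c = c - r] for [r < c] and a 0/1 weakly monotone array below the
   diagonal, which is encoded by thresholds [t_0 <= ... <= t_{n-1}] with
   [t_r <= r]; these are counted by the Catalan numbers. *)

(** * Partial sums and corner sums *)

Section PartialSums.
Local Open Scope ring_scope.
Variables (n : nat) (v : 'I_n -> int).

Definition psum (k : nat) : int := \sum_(j < n | (j < k)%N) v j.
Definition ssum (k : nat) : int := \sum_(j < n | (k <= j)%N) v j.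

Lemma psum0 : psum 0 = 0.
Proof. by rewrite /psum big_pred0. Qed.

Lemma psumS (k : 'I_n) : psum k.+1 = psum k + v k.
Proof.
rewrite /psum (bigD1 k) //= addrC; congr (_ + _).
by apply: eq_bigl => j; rewrite -val_eqE /=; lia.
Qed.

Lemma psum_total k : (n <= k)%N -> psum k = \sum_j v j.
Proof. by move=> nk; apply: eq_bigl => j; rewrite (leq_trans (ltn_ord j)). Qed.

Lemma ssumS (k : 'I_n) : ssum k = v k + ssum k.+1.
Proof.
rewrite /ssum (bigD1 k) //=; congr (_ + _).
by apply: eq_bigl => j; rewrite -val_eqE /=; lia.
Qed.

Lemma ssum_out k : (n <= k)%N -> ssum k = 0.
Proof.
move=> nk; rewrite /ssum big_pred0 // => j.
by apply: negbTE; rewrite -ltnNge (leq_trans (ltn_ord j)).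
Qed.

Lemma psum_ssum k : psum k + ssum k = \sum_j v j.
Proof.
rewrite (bigID (fun j : 'I_n => (j < k)%N)) /=; congr (_ + _).
by apply: eq_bigl => j; rewrite -leqNgt.
Qed.

Hypothesis v_entry : forall j, v j \in [:: 0; 1; -1].

(** Generalized to windows for the induction: the sum over a window is 0 or its last nonzero entry
    [v l]. By alternation the next nonzero entry is [- v l], which swaps the two cases. *)
Lemma alternating_psum_diff m k : alternating v -> (m <= k <= n)%N ->
  psum k - psum m = 0 /\ (forall l : 'I_n, (m <= l < k)%N -> v l = 0) \/
  exists l : 'I_n, [/\ (m <= l < k)%N, v l != 0,
     forall j : 'I_n, (l < j < k)%N -> v j = 0
     & psum k - psum m = 0 \/ psum k - psum m = v l].
Proof.
move=> alt; elim: k => [|k IH] /andP[mk kn].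
  by left; split=> [|l]; [rewrite (_ : m = 0%N) ?subrr; lia | lia].
case: (ltnP k m) => [km|mk'].
  by left; split=> [|l]; [rewrite (_ : m = k.+1) ?subrr; lia | lia].
pose K := Ordinal kn; have pS : psum k.+1 = psum k + v K by apply: (psumS K).
have IH' := IH ltac:(lia).
have [vK|vK] := eqVneq (v K) 0.
  rewrite pS vK addr0; case: IH' => [[-> z]|[l [ml vl zl dl]]]; [left|right].
    split=> // l lk; have [->//|lK] := eqVneq l K.
    by apply: z; move: lK; rewrite -val_eqE /=; lia.
  exists l; split=> //; first lia.
  move=> j jl; have [->//|lK] := eqVneq j K.
  by apply: zl; move: lK; rewrite -val_eqE /=; lia.
right; exists K; split=> //=; first lia; first by move=> j; lia.
case: IH' => [[e z]|[l [ml vl zl dl]]]; first by right; rewrite pS; lia.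
have vKl : v K = - v l.
  move/forallP/(_ l)/forallP/(_ K)/implyP: alt => alt; apply/eqP/alt.
  rewrite vl vK /= (_ : l < k)%N ?andTb; last lia.
  by apply/forallP => j; apply/implyP => jl; apply/eqP/zl.
by case: dl => e; [right | left]; rewrite pS; lia.
Qed.

(** The prefix before [k] and the suffix from [k] are both windows, so their sums lie in [-1, 1];
    since they add up to 1, both are nonnegative. *)
Lemma alternating_psum k : alternating v -> \sum_j v j = 1 ->
  0 <= psum k <= 1.
Proof.
move=> alt tot; case: (leqP n k) => [nk|kn]; first by rewrite psum_total // tot.
have b l : -1 <= v l <= 1.
  by move: (v_entry l); rewrite !inE => /or3P[] /eqP ->.
have := @alternating_psum_diff 0 k alt ltac:(lia).
have := @alternating_psum_diff k n alt ltac:(lia).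
rewrite psum0 (psum_total (leqnn n)) tot => h1 h2.
have : -1 <= 1 - psum k <= 1.
  case: h1 => [[-> _]//|[l [_ _ _]]]; have := b l; lia.
have : -1 <= psum k - 0 <= 1.
  case: h2 => [[-> _]//|[l [_ _ _]]]; have := b l; lia.
lia.
Qed.

Lemma psum_const l k : (l <= k)%N -> (k <= n)%N ->
  (forall j : 'I_n, (l <= j < k)%N -> v j = 0) -> psum k = psum l.
Proof.
elim: k => [|k IH] lk kn z; first by congr psum; lia.
case: (ltnP k l) => [kl|lk']; first by congr psum; lia.
rewrite (psumS (Ordinal kn)) z /=; last lia.
by rewrite addr0 IH //; [lia | move=> j jk; apply: z; lia].
Qed.

(** Partial sums are constant between two consecutive nonzero entries, so two jumps of the same sign
    would leave [0, 1]. *)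
Lemma psum_alternating : (forall k, 0 <= psum k <= 1) -> alternating v.
Proof.
move=> b; apply/forallP => j; apply/forallP => k; apply/implyP.
case/and4P=> jk vj vk /forallP z.
have e : psum k = psum j.+1.
  apply: psum_const => //; first exact: ltnW.
  by move=> l jl; apply/eqP; have /implyP := z l; apply; lia.
have := psumS k; have := psumS j.
have := b k.+1; have := b k; have := b j; have := b j.+1.
have /negP := vj; have /negP := vk.
lia.
Qed.

End PartialSums.

(** * Alternating sign matrices through bounded partial sums *)

Section Asm.
Local Open Scope ring_scope.
Variable n : nat.
Implicit Types A B : 'M[entry]_n.

Definition rsum A (r : 'I_n) (c : nat) : int := psum (int_mx A r) c.
(** Columns are summed from the bottom, so that [rsum] and [csum] are the increments of [corner] in
    its two arguments. *)
Definition csum A (r : nat) (c : 'I_n) : int := ssum (int_mx A ^~ c) r.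
Definition corner A (r c : nat) : int :=
  \sum_(i < n | (r <= i)%N) rsum A i c.

Lemma int_mx_entry A r c : int_mx A r c \in [:: 0; 1; -1].
Proof. by rewrite mxE; apply: (ssvalP (A r c)). Qed.

Lemma int_mx_inj : injective (@int_mx n).
Proof.
move=> A B /matrixP AB; apply/matrixP => i j.
by apply: val_inj; have := AB i j; rewrite !mxE.
Qed.

Lemma asmP A : reflect
  [/\ forall r c, 0 <= rsum A r c <= 1, forall r c, 0 <= csum A r c <= 1,
      forall r, rsum A r n = 1 & forall c, csum A 0 c = 1] (is_asm A).
Proof.
have total_c c : csum A 0 c = \sum_i int_mx A i c.
  by rewrite -(psum_ssum _ 0) psum0 add0r.
have total_r r : rsum A r n = \sum_j int_mx A r j by apply: psum_total.
apply: (iffP and4P) => [[/forallP h1 /forallP h2 /forallP h3 /forallP h4]|].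
  split=> [r c|r c|r|c].
  - by apply: alternating_psum (h3 r) (eqP (h1 r)) => j; apply: int_mx_entry.
  - have := psum_ssum (int_mx A ^~ c) r; rewrite (eqP (h2 c)) -/(csum A r c).
    have := alternating_psum (fun j => int_mx_entry A j c) r (h4 c) (eqP (h2 c)).
    lia.
  - by rewrite total_r (eqP (h1 r)).
  - by rewrite total_c (eqP (h2 c)).
case=> h1 h2 h3 h4; split; apply/forallP => k.
- by rewrite -total_r h3.
- by rewrite -total_c h4.
- by apply: psum_alternating => c; apply: h1.
apply: psum_alternating => r.
have := psum_ssum (int_mx A ^~ k) r; rewrite -total_c h4 -/(csum A r k).
have := h2 r k; lia.
Qed.
End Asm.

(** * Corner sums and their bounds *)

Section Corner.
Local Open Scope ring_scope.
Variable n : nat.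
Implicit Types A B : 'M[entry]_n.

(** Common form of [rsum], [csum] and [corner], so that the effect of a removal on all three is
    computed once. *)
Definition pos_sum A (P : pred (pos n)) : int :=
  \sum_(x : pos n | P x) int_mx A x.1 x.2.

Lemma rsum_pos_sum A r c :
  rsum A r c = pos_sum A (fun x => (x.1 == r) && (x.2 < c)%N).
Proof.
rewrite /pos_sum -(pair_big_dep (pred1 r) (fun _ (j : 'I_n) => (j < c)%N)
  (fun i j => int_mx A i j)) /=.
by rewrite big_pred1_eq.
Qed.

Lemma csum_pos_sum A r c :
  csum A r c = pos_sum A (fun x => (x.2 == c) && (r <= x.1)%N).
Proof.
transitivity (pos_sum A (fun x => (r <= x.1)%N && (x.2 == c))).
  rewrite /pos_sum -(pair_big_dep (fun i : 'I_n => r <= i)%N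
    (fun _ (j : 'I_n) => j == c) (fun i j => int_mx A i j)) /=.
  by apply: eq_bigr => i _; rewrite big_pred1_eq.
by apply: eq_bigl => x; rewrite andbC.
Qed.

Lemma corner_pos_sum A r c :
  corner A r c = pos_sum A (fun x => (r <= x.1)%N && (x.2 < c)%N).
Proof.
by rewrite /pos_sum -(pair_big_dep (fun i : 'I_n => r <= i)%N
  (fun _ (j : 'I_n) => (j < c)%N) (fun i j => int_mx A i j)).
Qed.

Lemma corner_row A (r : 'I_n) c : corner A r c = rsum A r c + corner A r.+1 c.
Proof. exact: (ssumS (fun i => rsum A i c)). Qed.

Lemma corner_col A r (c : 'I_n) : corner A r c.+1 = corner A r c + csum A r c.
Proof.
rewrite /corner /csum /ssum -big_split; apply: eq_bigr => i _.
exact: psumS.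
Qed.

Lemma corner_bottom A r c : (n <= r)%N -> corner A r c = 0.
Proof. exact: ssum_out. Qed.

Lemma corner_left A r : corner A r 0 = 0.
Proof. by rewrite /corner big1 // => i _; apply: psum0. Qed.

Lemma rsumS A r (c : 'I_n) : rsum A r c.+1 = rsum A r c + int_mx A r c.
Proof. exact: psumS. Qed.

Lemma csumS A (r : 'I_n) c : csum A r c = int_mx A r c + csum A r.+1 c.
Proof. exact: ssumS. Qed.

Lemma corner_entry A (r c : 'I_n) :
  int_mx A r c = corner A r c.+1 - corner A r.+1 c.+1 - corner A r c
                 + corner A r.+1 c.
Proof. by rewrite !corner_col (csumS A r); lia. Qed.

Lemma asm_corner_top A c : is_asm A -> (c <= n)%N -> corner A 0 c = c%:Z.
Proof.
case/asmP=> _ _ _ h; elim: c => [|c IH] cn; first exact: corner_left.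
by rewrite (corner_col A 0 (Ordinal cn)) h IH; lia.
Qed.

(** The corner sum is [c] at the top, and each row left out lowers it by a prefix sum, which is at
    most 1. *)
Lemma asm_corner_ge A r c : is_asm A -> (r <= n)%N -> (c <= n)%N ->
  c%:Z - r%:Z <= corner A r c.
Proof.
move=> asmA rn cn; case/asmP: (asmA) => h _ _ _.
elim: r rn => [|r IH] rn; first by rewrite asm_corner_top ?subr0.
have := corner_row A (Ordinal rn) c; have := h (Ordinal rn) c => /=.
have := IH ltac:(lia); lia.
Qed.

Lemma asm_corner_anti A r r' c c' : is_asm A -> (r <= r')%N -> (c' <= c)%N ->
  (c <= n)%N -> corner A r' c' <= corner A r c.
Proof.
move=> asmA rr cc cn; case/asmP: (asmA) => h1 h2 _ _.
apply: (@le_trans _ _ (corner A r' c)).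
  elim: c cc cn => [|c IH] cc cn; first by rewrite (_ : c' = 0%N) ?lexx; lia.
  case: (ltnP c c') => [lt|le]; first by rewrite (_ : c' = c.+1) ?lexx; lia.
  have := corner_col A r' (Ordinal cn); have := h2 r' (Ordinal cn).
  have := IH le ltac:(lia) => /=; lia.
elim: r' rr => [|r' IH] rr; first by rewrite (_ : r = 0%N) ?lexx; lia.
case: (ltnP r' r) => [lt|le]; first by rewrite (_ : r = r'.+1) ?lexx; lia.
case: (ltnP r' n) => [r'n|nr'].
  have := corner_row A (Ordinal r'n) c; have := h1 (Ordinal r'n) c.
  have := IH le => /=; lia.
by have := IH le; rewrite (corner_bottom A c nr') (corner_bottom A c (leqW nr')).
Qed.

(* That is, A lies below the permutation 23...n1 in the ASM lattice. *)
Definition low A := forall r c, (c <= r.+1)%N -> corner A r c <= 1.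

(** For the upper bound, [low] gives 1 at column [r.+1], and each further column adds at most 1. *)
Lemma low_corner A r c : is_asm A -> low A -> (r < c)%N -> (c <= n)%N ->
  corner A r c = c%:Z - r%:Z.
Proof.
move=> asmA lowA rc cn; apply/eqP; rewrite eq_le asm_corner_ge ?andbT //; last lia.
case/asmP: (asmA) => _ h _ _.
elim: c rc cn => [//|c IH] rc cn.
have [e|rc'] := eqVneq r c; first by have := lowA r c.+1; rewrite e; lia.
rewrite (corner_col A r (Ordinal cn)); have := h r (Ordinal cn).
have := IH ltac:(lia) ltac:(lia) => /=; lia.
Qed.

End Corner.

(** * One removal step *)

(* [fst] and [snd] on [pos n] may carry [Finite.sort 'I_n] or ['I_n] as type
   arguments, which [lia] does not identify. *)
Ltac pos_lia := simpl in *; lia.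

Section Step.
Local Open Scope ring_scope.
Variables (n : nat) (A : 'M[entry]_n) (p : pos n) (i0 j0 : 'I_n).
Hypotheses (asmA : is_asm A) (rem_p : removable A p).
Hypotheses (south_p : nearest_south A p i0) (west_p : nearest_west A p j0).

Let M := moved A p i0 j0.
Let B := sw_remove A p i0 j0.
Let qw : pos n := (p.1, j0).
Let qs : pos n := (i0, p.2).

Lemma pos_eqE (x y : pos n) : (x == y) = (x.1 == y.1 :> nat) && (x.2 == y.2 :> nat).
Proof. by []. Qed.

Lemma pos_eq (x y : pos n) : x.1 = y.1 :> nat -> x.2 = y.2 :> nat -> x = y.
Proof. by move=> e1 e2; apply/eqP; rewrite pos_eqE e1 e2 !eqxx. Qed.

Lemma neg_p : int_mx A p.1 p.2 = -1.
Proof. by case/andP: rem_p => /eqP. Qed.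

Lemma sw_nonneg x : weakly_sw x p -> x != p -> 0 <= int_mx A x.1 x.2.
Proof.
case/andP: rem_p => _ /forallP /(_ x) /implyP h sw xp.
have := int_mx_entry A x.1 x.2; rewrite !inE => /or3P[] /eqP e; rewrite ?e //.
by case/negP: xp; apply: h; rewrite /is_neg e sw.
Qed.

(** Both nearest 1s are themselves neighboring, and a neighboring 1 outside the rectangle would have
    one of them between it and [p]. So the rectangle condition can be forgotten. *)
Lemma moved_neighboring q : (q \in M) = neighboring A p q.
Proof.
case/and3P: south_p => lts ones /forallP bs.
case/and3P: west_p => ltw onew /forallP bw.
rewrite inE; apply/idP/idP.
  case/or3P=> [/eqP->|/eqP->|/and3P[]//]; apply/and3P; split=> //.
  - by rewrite /weakly_sw /= leqnn ltnW.
  - apply/forallP => z; apply/implyP => /and3P[onez /andP[/= a1 a2] /andP[a3 a4]].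
    have e1 : z.1 = p.1 by apply: ord_inj; pos_lia.
    rewrite pos_eqE /= e1 eqxx /=; apply: contraT => ne.
    have zp : z.2 != p.2 :> nat.
      apply: contraTneq onez => e2; rewrite /is_one (_ : z = p) ?neg_p //.
      by apply: pos_eq; rewrite ?e1.
    have /implyP := bw z.2; rewrite -e1 -surjective_pairing onez.
    by move=> /(_ ltac:(pos_lia)).
  - by rewrite /weakly_sw /= leqnn ltnW.
  apply/forallP => z; apply/implyP => /and3P[onez /andP[/= a1 a2] /andP[a3 a4]].
  have e1 : z.2 = p.2 by apply: ord_inj; pos_lia.
  rewrite pos_eqE /= e1 eqxx andbT; apply: contraT => ne.
  have zp : z.1 != p.1 :> nat.
    apply: contraTneq onez => e2; rewrite /is_one (_ : z = p) ?neg_p //.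
    by apply: pos_eq; rewrite ?e1.
  have /implyP := bs z.1; rewrite -e1 -surjective_pairing onez.
  by move=> /(_ ltac:(pos_lia)).
move=> nq; case/and3P: (nq) => oneq /andP[sw1 sw2] /forallP mx.
rewrite nq /= sw1 sw2 /= andbT.
case: (leqP q.1 i0) => qi.
  case: (leqP j0 q.2) => qj; first by rewrite !orbT.
  have /implyP/(_ _)/eqP <- := mx qw; first by rewrite eqxx.
  by rewrite onew /weakly_sw /=; pos_lia.
have /implyP/(_ _)/eqP <- := mx qs; first by rewrite eqxx orbT.
by rewrite ones /weakly_sw /=; pos_lia.
Qed.

Lemma moved_one q : q \in M -> int_mx A q.1 q.2 = 1.
Proof. by rewrite moved_neighboring => /and3P[/eqP]. Qed.

Lemma moved_sw q : q \in M -> weakly_sw q p.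
Proof. by rewrite moved_neighboring => /and3P[]. Qed.

Lemma qw_moved : qw \in M. Proof. by rewrite inE eqxx. Qed.
Lemma qs_moved : qs \in M. Proof. by rewrite inE eqxx orbT. Qed.

Lemma moved_anti q z : q \in M -> z \in M -> weakly_sw q z -> q = z.
Proof.
rewrite !moved_neighboring => /and3P[_ _ /forallP mx] /and3P[onez swz _] qz.
by have /implyP/(_ _)/eqP -> := mx z; rewrite // onez qz.
Qed.

(** An antichain for the southwest order runs from northwest to southeast: columns and rows increase
    together. *)
Lemma moved_chain q z : q \in M -> z \in M -> (q.2 < z.2)%N = (q.1 < z.1)%N.
Proof.
move=> qM zM; have [->|qz] := eqVneq q z; first by rewrite !ltnn.
have n1 : ~~ weakly_sw q z by apply: contra_neqN qz; apply: moved_anti.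
have n2 : ~~ weakly_sw z q by apply: contra_neqN qz => /moved_anti ->.
move: n1 n2; rewrite /weakly_sw; pos_lia.
Qed.

Lemma moved_col_inj q z : q \in M -> z \in M -> q.2 = z.2 :> nat -> q = z.
Proof.
move=> qM zM e; have := moved_chain qM zM; have := moved_chain zM qM.
by rewrite e ltnn => a b; apply: pos_eq => //; pos_lia.
Qed.

Lemma moved_row_inj q z : q \in M -> z \in M -> q.1 = z.1 :> nat -> q = z.
Proof.
move=> qM zM e; have := moved_chain qM zM; have := moved_chain zM qM.
by rewrite e ltnn => a b; apply: pos_eq => //; pos_lia.
Qed.

Lemma moved_col_ge q : q \in M -> (j0 <= q.2)%N.
Proof.
move=> qM; have := moved_chain qM qw_moved; case/andP: (moved_sw qM) => /=; pos_lia.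
Qed.

(** The neighbors of a moved 1 in the east-to-west listing. On [M] the defaults occur only at the
    ends, [qw] for [next] and [qs] for [prev]. *)
Definition next q : pos n := odflt q [pick z | next_west M q z].
Definition prev z : pos n := odflt z [pick q | next_west M q z].

Lemma nextP q : q \in M :\ qw -> next_west M q (next q).
Proof.
case/setD1P=> qqw qM; rewrite /next; case: pickP => //= none.
have wM : (qw \in M) && (qw.2 < q.2)%N.
  rewrite qw_moved /=; have := moved_col_ge qM; have := moved_col_inj qM qw_moved.
  by rewrite /= => i ge; rewrite ltn_neqAle ge andbT; apply: contra_neqN qqw => /eqP/esym.
(* The successor is the eastmost of the moved 1s lying west of [q]. *)
case: (@arg_maxnP _ qw (fun z => (z \in M) && (z.2 < q.2)%N) (fun z => z.2) wM).
move=> z /andP[zM zq] mx; have /negP[] := none z.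
rewrite /next_west qM zM zq /=; apply/forallP => y; apply/implyP => yM.
by apply/negP => /andP[zy yq]; have := mx y; rewrite yM yq; pos_lia.
Qed.

Lemma prevP q : q \in M :\ qs -> next_west M (prev q) q.
Proof.
case/setD1P=> qqs qM; rewrite /prev; case: pickP => //= none.
have sM : (qs \in M) && (q.2 < qs.2)%N.
  rewrite qs_moved /=; case/andP: (moved_sw qM) => _ le.
  have := moved_col_inj qM qs_moved.
  by rewrite /= => i; rewrite ltn_neqAle le andbT; apply: contra_neqN qqs => /eqP.
case: (@arg_minnP _ qs (fun z => (z \in M) && (q.2 < z.2)%N) (fun z => z.2) sM).
move=> z /andP[zM zq] mx; have /negP[] := none z.
rewrite /next_west qM zM zq /=; apply/forallP => y; apply/implyP => yM.
by apply/negP => /andP[zy yq]; have := mx y; rewrite yM zy; pos_lia.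
Qed.

(** Two indexings of the new 1s, by the moved 1 in the same row or in the same column; row sums use
    the first, column sums the second. *)
Definition next_pos q : pos n := (q.1, (next q).2).
Definition prev_pos q : pos n := ((prev q).1, q.2).

Lemma placed_next : [set x | placed M x] = next_pos @: (M :\ qw).
Proof.
apply/setP => x; rewrite inE; apply/idP/imsetP.
  case/existsP=> a /existsP[b /and3P[nab /eqP e1 /eqP e2]].
  case/and4P: (nab) => aM bM ba /forallP btw.
  have aD : a \in M :\ qw.
    rewrite in_setD1 aM andbT; apply: contraTneq ba => ->.
    by rewrite -leqNgt moved_col_ge.
  exists a => //; apply: pos_eq; rewrite /= ?e1 // e2.
  case/and4P: (nextP aD) => _ nM na /forallP btw'.
  have := btw (next a); have := btw' b; rewrite bM nM; pos_lia.
case=> q qD ->; apply/existsP; exists q; apply/existsP; exists (next q).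
by rewrite nextP //= !eqxx.
Qed.

Lemma placed_prev : [set x | placed M x] = prev_pos @: (M :\ qs).
Proof.
apply/setP => x; rewrite inE; apply/idP/imsetP.
  case/existsP=> a /existsP[b /and3P[nab /eqP e1 /eqP e2]].
  case/and4P: (nab) => aM bM ba /forallP btw.
  have bD : b \in M :\ qs.
    rewrite in_setD1 bM andbT; apply: contraTneq ba => ->.
    by rewrite -leqNgt; case/andP: (moved_sw aM).
  exists b => //; apply: pos_eq; rewrite /= ?e2 // e1.
  case/and4P: (prevP bD) => nM _ na /forallP btw'.
  rewrite (@moved_col_inj a (prev b)) //.
  have := btw (prev b); have := btw' a; rewrite aM nM; pos_lia.
case=> q qD ->; apply/existsP; exists (prev q); apply/existsP; exists q.
by rewrite prevP //= !eqxx.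
Qed.

Lemma next_pos_inj : {in M :\ qw &, injective next_pos}.
Proof.
move=> x y /setD1P[_ xM] /setD1P[_ yM] [e _].
by apply: moved_row_inj; rewrite ?e.
Qed.

Lemma prev_pos_inj : {in M :\ qs &, injective prev_pos}.
Proof.
move=> x y /setD1P[_ xM] /setD1P[_ yM] [_ e].
by apply: moved_col_inj; rewrite ?e.
Qed.

(** * Partial sums southwest of [p], where all other entries are nonnegative *)

Lemma rsum_sw_mono (r : 'I_n) c c' : (p.1 <= r)%N -> (c <= c' <= p.2)%N ->
  rsum A r c <= rsum A r c'.
Proof.
move=> pr; elim: c' => [|c' IH] cc; first by rewrite (_ : c = 0%N) ?lexx; pos_lia.
case: (ltnP c' c) => [lt|le]; first by rewrite (_ : c = c'.+1) ?lexx; pos_lia.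
have c'n : (c' < n)%N by have := ltn_ord p.2; pos_lia.
rewrite (rsumS A r (Ordinal c'n)).
have := @sw_nonneg (r, Ordinal c'n); rewrite /weakly_sw pos_eqE /=.
have := IH ltac:(pos_lia); pos_lia.
Qed.

Lemma csum_sw_mono r r' (c : 'I_n) : (c <= p.2)%N -> (p.1 < r <= r')%N ->
  csum A r' c <= csum A r c.
Proof.
move=> pc; elim: r' => [|r' IH] rr; first pos_lia.
case: (ltnP r' r) => [lt|le]; first by rewrite (_ : r = r'.+1) ?lexx; pos_lia.
have := IH ltac:(pos_lia); case: (ltnP r' n) => [r'n|nr'].
  have := csumS A (Ordinal r'n) c.
  have := @sw_nonneg (Ordinal r'n, c); rewrite /weakly_sw pos_eqE /=; pos_lia.
by rewrite /csum (ssum_out _ nr') (ssum_out _ (leqW nr')).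
Qed.

(** The prefix sums grow up to column [q.2], where adding the 1 at [q] must not exceed 1; hence they
    vanish before it. *)
Lemma moved_rsum q c : q \in M -> (c <= q.2)%N -> rsum A q.1 c = 0.
Proof.
move=> qM cq; case/asmP: asmA => h _ _ _; case/andP: (moved_sw qM) => sw1 sw2.
have := rsumS A q.1 q.2; rewrite moved_one //.
have := h q.1 q.2.+1; have := h q.1 c.
have := @rsum_sw_mono q.1 c q.2 sw1 ltac:(pos_lia); pos_lia.
Qed.

Lemma moved_csum q r : q \in M -> (q.1 < r)%N -> csum A r q.2 = 0.
Proof.
move=> qM cq; case/asmP: asmA => _ h _ _; case/andP: (moved_sw qM) => sw1 sw2.
have := csumS A q.1 q.2; rewrite moved_one //.
have := h q.1 q.2; have := h r q.2.
have := @csum_sw_mono q.1.+1 r q.2 sw2 ltac:(pos_lia); pos_lia.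
Qed.

(** The new position lies strictly west of [q], where all prefix sums of the row vanish: new 1s only
    replace zeros. *)
Lemma next_pos_entry q : q \in M :\ qw ->
  int_mx A (next_pos q).1 (next_pos q).2 = 0.
Proof.
move=> qD; case/and4P: (nextP qD) => qM _ lt _.
have := rsumS A q.1 (next q).2; rewrite !moved_rsum //=; last exact: ltnW.
by rewrite add0r => <-.
Qed.

(** The new positions, the moved 1s and [p] carry 0, 1 and -1, hence are disjoint, and the cases of
    [sw_remove] become additive corrections. *)
Lemma sw_remove_entry x : int_mx B x.1 x.2 =
  int_mx A x.1 x.2 + (x == p)%:Z - (x \in M)%:Z + (x \in [set x | placed M x])%:Z.
Proof.
have -> : int_mx B x.1 x.2 = if placed M x then 1 else
    if (x \in M) || (x == p) then 0 else int_mx A x.1 x.2.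
  by rewrite !mxE -surjective_pairing -/M; case: ifP => // _; case: ifP.
rewrite placed_next.
have -> : placed M x = (x \in next_pos @: (M :\ qw)) by rewrite -placed_next inE.
case: imsetP => [[q qD ->]|_].
  rewrite next_pos_entry //; case/and4P: (nextP qD) => qM _ lt _.
  have np : next_pos q != p.
    by rewrite pos_eqE /=; case/andP: (moved_sw qM); pos_lia.
  have nM : next_pos q \notin M.
    by apply/negP => /moved_one; rewrite next_pos_entry.
  by rewrite (negbTE np) (negbTE nM).
have [xM|] := boolP (x \in M) => /=; last first.
  by have [->|] := eqVneq x p; rewrite ?neg_p //= => _ _; pos_lia.
rewrite moved_one //; have [e|//] := eqVneq x p.
by move: (moved_one xM); rewrite e neg_p.
Qed.

Lemma sum_indicator_exchange (P : pred (pos n)) (D : {set pos n}) :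
  \sum_(x | P x) ((x \in D)%:Z) = \sum_(x in D) ((P x)%:Z).
Proof.
rewrite big_mkcond [RHS]big_mkcond; apply: eq_bigr => x _.
by case: (P x); case: (x \in D).
Qed.

Lemma pos_sum_remove (P : pred (pos n)) : pos_sum B P = pos_sum A P + (P p)%:Z
  - \sum_(q in M) (P q)%:Z + \sum_(x in [set x | placed M x]) (P x)%:Z.
Proof.
rewrite /pos_sum; under eq_bigr => x _ do rewrite sw_remove_entry.
rewrite !big_split /= -!sum_indicator_exchange sumrN.
congr (_ + _ - _ + _).
have -> : (P p)%:Z = \sum_(x in [set p]) (P x)%:Z by rewrite big_set1.
by rewrite -sum_indicator_exchange; apply: eq_bigr => x _; rewrite inE.
Qed.

(* Each moved 1 other than the westmost one is paired with the new 1 in its row;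
   [pos_sum_prev] pairs along columns instead. *)
Lemma pos_sum_next (P : pred (pos n)) : pos_sum B P =
  pos_sum A P + (P p)%:Z - (P qw)%:Z
  + \sum_(q in M :\ qw) ((P (next_pos q))%:Z - (P q)%:Z).
Proof.
rewrite pos_sum_remove placed_next big_imset /=; last exact: next_pos_inj.
rewrite (big_setD1 _ qw_moved) /= sumrB opprD -!addrA.
by congr (_ + (_ + (_ + _))); exact: addrC.
Qed.

Lemma pos_sum_prev (P : pred (pos n)) : pos_sum B P =
  pos_sum A P + (P p)%:Z - (P qs)%:Z
  + \sum_(q in M :\ qs) ((P (prev_pos q))%:Z - (P q)%:Z).
Proof.
rewrite pos_sum_remove placed_prev big_imset /=; last exact: prev_pos_inj.
rewrite (big_setD1 _ qs_moved) /= sumrB opprD -!addrA.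
by congr (_ + (_ + (_ + _))); exact: addrC.
Qed.

(** A row with a moved 1 other than [qw] has that 1 shifted west; the row of [p] loses its -1 and
    the 1 at [qw]; any other row is unchanged. *)
Lemma rsum_remove r c : 0 <= rsum B r c <= 1 /\ rsum B r n = 1.
Proof.
case/asmP: asmA => h1 _ h3 _; have ltn := ltn_ord.
case/and3P: west_p => ltw _ _.
have e d : rsum B r d = rsum A r d + ((p.1 == r) && (p.2 < d)%N)%:Z
    - ((p.1 == r) && (j0 < d)%N)%:Z + \sum_(q in M :\ qw)
      (((q.1 == r) && ((next q).2 < d)%N)%:Z - ((q.1 == r) && (q.2 < d)%N)%:Z).
  by rewrite !rsum_pos_sum pos_sum_next.
case: (pickP (fun q => (q \in M :\ qw) && (q.1 == r))) => [q /andP[qD /eqP qr]|none].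
  case/setD1P: (qD) => qqw qM; case/and4P: (nextP qD) => _ _ nlt _.
  have {}e d : rsum B r d =
      rsum A r d + ((next q).2 < d)%N%:Z - (q.2 < d)%N%:Z.
    have /negbTE pr : p.1 != r.
      apply: contra_neq qqw => pr; apply: moved_row_inj => //.
        exact: qw_moved.
      by rewrite qr -pr.
    rewrite e pr (bigD1 q) //= qr eqxx big1 => [|z /andP[/setD1P[_ zM] zq]].
      by rewrite /=; lia.
    suff /negbTE-> : z.1 != r by [].
    apply: contra_neq zq => zr; apply: moved_row_inj => //.
    by rewrite zr qr.
  split; rewrite e; last by rewrite h3 !ltn.
  have := h1 r c; case: (leqP c q.2) => cq; last by pos_lia.
  (* The prefix sum was 0 up to column [q.2], so the shifted 1 raises it to at most 1. *)
  have -> : rsum A r c = 0 by rewrite -qr moved_rsum.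
  by pos_lia.
have {}e d : rsum B r d = rsum A r d + ((p.1 == r) && (p.2 < d)%N)%:Z
    - ((p.1 == r) && (j0 < d)%N)%:Z.
  rewrite e big1 ?addr0 // => q qD.
  by have := none q; rewrite qD /= => ->.
split; rewrite e; last by rewrite h3 !ltn; case: (p.1 == r).
have := h1 r c; have [pr|_] := eqVneq p.1 r; last by rewrite /=; lia.
case: (leqP c p.2) => cp; case: (ltnP j0 c) => jc; rewrite /=; try lia.
(* Between [qw] and [p] the old prefix sum is at least 1, so losing the 1 at [qw] leaves it
   nonnegative. *)
rewrite -pr; have := @rsum_sw_mono p.1 j0.+1 c (leqnn _) ltac:(lia).
rewrite rsumS (moved_one qw_moved) (moved_rsum qw_moved) //; lia.
Qed.

(** The transposed argument: a moved 1 other than [qs] is shifted down its column. *)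
Lemma csum_remove r c : 0 <= csum B r c <= 1 /\ csum B 0 c = 1.
Proof.
case/asmP: asmA => _ h2 _ h4.
case/and3P: south_p => lts _ _.
have e d : csum B d c = csum A d c + ((p.2 == c) && (d <= p.1)%N)%:Z
    - ((p.2 == c) && (d <= i0)%N)%:Z + \sum_(q in M :\ qs)
      (((q.2 == c) && (d <= (prev q).1)%N)%:Z - ((q.2 == c) && (d <= q.1)%N)%:Z).
  by rewrite !csum_pos_sum pos_sum_prev.
case: (pickP (fun q => (q \in M :\ qs) && (q.2 == c))) => [q /andP[qD /eqP qc]|none].
  case/setD1P: (qD) => qqs qM; case/and4P: (prevP qD) => vM _ vlt _.
  have {}e d : csum B d c =
      csum A d c + (d <= (prev q).1)%N%:Z - (d <= q.1)%N%:Z.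
    have /negbTE pc : p.2 != c.
      apply: contra_neq qqs => pc; apply: moved_col_inj => //.
        exact: qs_moved.
      by rewrite qc -pc.
    rewrite e pc (bigD1 q) //= qc eqxx big1 => [|z /andP[/setD1P[_ zM] zq]].
      by rewrite /=; lia.
    suff /negbTE-> : z.2 != c by [].
    apply: contra_neq zq => zc; apply: moved_col_inj => //.
    by rewrite zc qc.
  split; rewrite e; last by rewrite h4.
  have vlt1 : (q.1 < (prev q).1)%N by rewrite -moved_chain.
  have := h2 r c; case: (leqP r q.1) => rq; first by pos_lia.
  have -> : csum A r c = 0 by rewrite -qc moved_csum.
  by pos_lia.
have {}e d : csum B d c = csum A d c + ((p.2 == c) && (d <= p.1)%N)%:Z
    - ((p.2 == c) && (d <= i0)%N)%:Z.
  rewrite e big1 ?addr0 // => q qD.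
  by have := none q; rewrite qD /= => ->.
split; rewrite e; last by rewrite h4; case: (p.2 == c).
have := h2 r c; have [pc|_] := eqVneq p.2 c; last by rewrite /=; lia.
case: (leqP r p.1) => rp; case: (leqP r i0) => ri; rewrite /=; try lia.
rewrite -pc; have := @csum_sw_mono r i0 p.2 (leqnn _) ltac:(lia).
rewrite csumS (moved_one qs_moved) (moved_csum qs_moved) //; lia.
Qed.

Lemma asm_remove : is_asm B.
Proof.
apply/asmP; split=> [r c|r c|r|c].
- by case: (rsum_remove r c).
- by case: (csum_remove r c).
- by case: (rsum_remove r 0).
- by case: (csum_remove 0 c).
Qed.

Lemma corner_remove_ge r c : corner A r c <= corner B r c.
Proof.
case/and3P: west_p => ltw _ _; case/and3P: south_p => lts _ _.
(* The pairing is chosen so that the unpaired terms cancel: [p] and [qs] share a column and are both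
   in rows [>= r], or else [p] and [qw] are both in a row above [r]. Each pair moves a 1 south or
   west, which cannot lower a corner sum. *)
rewrite !corner_pos_sum; case: (leqP r p.1) => rp.
  rewrite pos_sum_prev -[leLHS]addr0 -!addrA lerD2l addrA addr_ge0 //=.
    by pos_lia.
  apply: sumr_ge0 => q qD; case/and4P: (prevP qD) => vM qM vlt _.
  by move: vlt; rewrite moved_chain //; pos_lia.
rewrite pos_sum_next -[leLHS]addr0 -!addrA lerD2l addrA addr_ge0 //=.
  by pos_lia.
by apply: sumr_ge0 => q qD; case/and4P: (nextP qD) => _ _ nlt _; pos_lia.
Qed.

(** The staircase is replaced by the whole quadrant southwest of [p], a bound that is enough for
    [low_remove]. *)
Lemma corner_remove_le r c :
  corner B r c <= corner A r c + ((p.1 < r) && (c <= p.2))%N%:Z.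
Proof.
case/and3P: west_p => ltw _ _; case/and3P: south_p => lts _ _.
rewrite !corner_pos_sum pos_sum_next -!addrA lerD2l addrA /=.
pose f (q : pos n) : int :=
  ((r <= q.1)%N && ((next q).2 < c)%N)%:Z - ((r <= q.1)%N && (q.2 < c)%N)%:Z.
rewrite -[X in _ + X <= _]/(\sum_(q in M :\ qw) f q).
(* Only the consecutive pair of moved 1s straddling column [c] contributes. *)
pose cross q := [&& q \in M :\ qw, (r <= q.1)%N, ((next q).2 < c)%N & (c <= q.2)%N].
have f_le q : q \in M :\ qw -> ~~ cross q -> f q <= 0.
  by rewrite /cross /f => -> /=; lia.
have f_le1 q : f q <= 1 by rewrite /f; lia.
(* From here on only the two bounds on [f] matter. *)
move: f f_le f_le1 => f f_le f_le1.
case: (pickP cross) => [q|none]; last first.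
  have : \sum_(q in M :\ qw) f q <= 0.
    by apply: sumr_le0 => q qD; apply: f_le; rewrite ?none.
  by pos_lia.
case/and4P=> qD rq nc cq; case/and4P: (nextP qD) => qM nM nlt btw.
have rest : \sum_(z in M :\ qw | z != q) f z <= 0.
  apply: sumr_le0 => z /andP[zD zq]; apply: f_le => //; apply/negP.
  case/and4P=> _ rz nz cz; case/and4P: (nextP zD) => zM _ _ /forallP btwz.
  have := btwz q; have /forallP/(_ z) := btw; rewrite qM zM /= => a b.
  case/negP: zq; apply/eqP/moved_col_inj => //; pos_lia.
have : \sum_(z in M :\ qw) f z <= 1.
  by rewrite (bigD1 q) //= -[leRHS]addr0 lerD.
(* A crossing pair forces [j0 < c <= p.2]. If [r <= p.1], its contribution is therefore cancelled by
   the loss of [qw]. *)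
case/andP: (moved_sw qM) => _; have := moved_col_ge nM; pos_lia.
Qed.

End Step.

(** * The key *)

Section Key.
Local Open Scope ring_scope.
Variable n : nat.
Implicit Types (A B K : 'M[entry]_n) (s : 'S_n).

Lemma asm_neg_rsum A p : is_asm A -> is_neg A p ->
  rsum A p.1 p.2 = 1 /\ rsum A p.1 p.2.+1 = 0.
Proof.
case/asmP=> h _ _ _ /eqP np; have := rsumS A p.1 p.2.
by rewrite np; have := h p.1 p.2; have := h p.1 p.2.+1; lia.
Qed.

Lemma asm_neg_csum A p : is_asm A -> is_neg A p -> csum A p.1.+1 p.2 = 1.
Proof.
case/asmP=> _ h _ _ /eqP np; have := csumS A p.1 p.2.
by rewrite np; have := h p.1 p.2; have := h p.1.+1 p.2; lia.
Qed.

(** Strictly above the diagonal, [low_corner] makes the prefix sum 1 just past the -1, where it must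
    be 0. Weakly below, the prefix sum 1 before the -1 already uses up the bound [corner <= 1]. *)
Lemma low_neg A p : is_asm A -> low A -> is_neg A p -> corner A p.1.+1 p.2 = 0.
Proof.
move=> asmA lowA np; have [e1 e2] := asm_neg_rsum asmA np.
have := corner_row A p.1 p.2.+1; have := corner_row A p.1 p.2.
rewrite e1 e2; case: (ltnP p.1 p.2) => cmp.
  have := @low_corner _ A p.1 p.2.+1 asmA lowA (ltnW cmp) (ltn_ord _).
  by have := @low_corner _ A p.1.+1 p.2.+1 asmA lowA cmp (ltn_ord _); lia.
have := lowA p.1 p.2; have := @asm_corner_anti _ A p.1.+1 p.1.+1 p.2 0 asmA.
rewrite corner_left; have := ltn_ord p.2; lia.
Qed.

(** The corner sum can grow only southwest of [p], where by [low_neg] and monotonicity it was at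
    most 0. *)
Lemma low_remove A p i0 j0 : is_asm A -> low A -> removable A p ->
  nearest_south A p i0 -> nearest_west A p j0 -> low (sw_remove A p i0 j0).
Proof.
move=> asmA lowA rp sp wp r c rc.
have := corner_remove_le asmA rp sp wp r c; have := lowA r c rc.
case: (boolP ((p.1 < r) && (c <= p.2))%N) => [/andP[pr cp]|_]; last by rewrite /=; lia.
case/andP: (rp) => np _; have := low_neg asmA lowA np.
have := @asm_corner_anti _ A p.1.+1 r p.2 c asmA pr cp (ltnW (ltn_ord _)).
by rewrite /=; lia.
Qed.

Lemma int_mx_one_or_le0 A x : is_one A x \/ int_mx A x.1 x.2 <= 0.
Proof.
rewrite /is_one; have := int_mx_entry A x.1 x.2.
by rewrite !inE => /or3P[] /eqP ->; [right|left|right].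
Qed.

Lemma exists_removable A x : is_neg A x -> exists p, removable A p.
Proof.
(* This weight strictly increases towards the southwest, so a maximal -1 has no other weakly
   southwest of it. *)
move=> nx; case: (@arg_maxnP _ x (is_neg A) (fun p => p.1 + (n - p.2))%N nx).
move=> p np mx; exists p; rewrite /removable np; apply/forallP => q.
apply/implyP => /andP[nq /andP[sw1 sw2]]; have := mx q nq.
rewrite pos_eqE; have := ltn_ord p.2; have := ltn_ord q.2; pos_lia.
Qed.

(** The prefix sum before a -1 is 1, so some 1 lies to its west. *)
Lemma exists_nearest_west A p : is_asm A -> is_neg A p ->
  exists j0, nearest_west A p j0.
Proof.
move=> asmA np; have [e _] := asm_neg_rsum asmA np.
case: (pickP (fun j : 'I_n => is_one A (p.1, j) && (j < p.2)%N)) => [j hj|none].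
  case: (@arg_maxnP _ j (fun j => is_one A (p.1, j) && (j < p.2)%N) (fun j => j) hj).
  move=> j0 /andP[one lt] mx; exists j0; rewrite /nearest_west lt one /=.
  apply/forallP => c; apply/implyP => /andP[jc cp]; apply/negP => onec.
  by have := mx c; rewrite onec cp; lia.
suff : rsum A p.1 p.2 <= 0 by rewrite e.
apply: sumr_le0 => j jp; case: (int_mx_one_or_le0 A (p.1, j)) => // one.
by have := none j; rewrite one jp.
Qed.

Lemma exists_nearest_south A p : is_asm A -> is_neg A p ->
  exists i0, nearest_south A p i0.
Proof.
move=> asmA np; have e := asm_neg_csum asmA np.
case: (pickP (fun i : 'I_n => is_one A (i, p.2) && (p.1 < i)%N)) => [i hi|none].
  case: (@arg_minnP _ i (fun i => is_one A (i, p.2) && (p.1 < i)%N) (fun i => i) hi).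
  move=> i0 /andP[one lt] mx; exists i0; rewrite /nearest_south lt one /=.
  apply/forallP => c; apply/implyP => /andP[jc cp]; apply/negP => onec.
  by have := mx c; rewrite onec jc; lia.
suff : csum A p.1.+1 p.2 <= 0 by rewrite e.
apply: sumr_le0 => i ip; case: (int_mx_one_or_le0 A (i, p.2)) => // one.
by have := none i; rewrite one ip.
Qed.

Lemma is_neg_remove A p i0 j0 x :
  is_neg (sw_remove A p i0 j0) x -> is_neg A x && (x != p).
Proof.
rewrite /is_neg !mxE -surjective_pairing.
by case: ifP => // _; case: ifP => // /norP[_ ->]; rewrite andbT.
Qed.

Lemma sw_step_asm A B : is_asm A -> sw_step A B -> is_asm B.
Proof.
move=> asmA /existsP[p /existsP[i0 /existsP[j0 /and4P[rp sp wp /eqP->]]]].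
exact: asm_remove.
Qed.

Lemma sw_step_corner A B r c : is_asm A -> sw_step A B ->
  corner A r c <= corner B r c.
Proof.
move=> asmA /existsP[p /existsP[i0 /existsP[j0 /and4P[rp sp wp /eqP->]]]].
exact: corner_remove_ge.
Qed.

Lemma connect_sw_step A K : is_asm A -> connect (@sw_step n) A K ->
  is_asm K /\ forall r c, corner A r c <= corner K r c.
Proof.
move=> asmA /connectP[l]; elim: l A asmA => [|B l IH] A asmA /=.
  by move=> _ ->; split.
case/andP=> st pth eK; have [asmK le] := IH B (sw_step_asm asmA st) pth eK.
by split=> // r c; apply: le_trans (le r c); apply: sw_step_corner.
Qed.

(** Induction on the number of -1s: a removal deletes one and creates none. *)
Lemma exists_final A : is_asm A -> exists K,
  [/\ connect (@sw_step n) A K, is_asm K, forall x, ~~ is_neg K x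
    & low A -> low K].
Proof.
have [m] := ubnP #|[set x | is_neg A x]|; elim: m A => // m IH A ltm asmA.
case: (pickP (is_neg A)) => [x nx|none]; last first.
  by exists A; split=> // x; rewrite none.
have [p rp] := exists_removable nx; have np : is_neg A p by case/andP: rp.
have [j0 wp] := exists_nearest_west asmA np.
have [i0 sp] := exists_nearest_south asmA np.
have [||K [cBK asmK nK lowK]] := IH (sw_remove A p i0 j0); last 1 first.
- exists K; split=> // [|lowA]; last by apply: lowK; apply: low_remove.
  apply: connect_trans cBK; apply: connect1; apply/existsP; exists p.
  by apply/existsP; exists i0; apply/existsP; exists j0; rewrite rp sp wp /=.
- rewrite -ltnS; apply: leq_trans ltm; rewrite ltnS.
  apply: proper_card; apply/properP; split.
    by apply/subsetP => y; rewrite !inE => /is_neg_remove/andP[].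
  exists p; rewrite inE //; apply/negP => /is_neg_remove.
  by rewrite eqxx andbF.
exact: asm_remove.
Qed.

Lemma nonneg_sum1_uniq (v : 'I_n -> int) a b : (forall i, 0 <= v i) ->
  \sum_i v i = 1 -> v a = 1 -> v b = 1 -> a = b.
Proof.
move=> v0 tot va vb; apply/eqP; apply: contraT => ab.
move: tot; rewrite (bigD1 a) //= (bigD1 b) /=; last by rewrite eq_sym.
rewrite va vb; set S := \sum_(_ < _ | _) _.
have : 0 <= S by apply: sumr_ge0.
lia.
Qed.

(** With nonnegative entries, row sums 1 select one column per row, and column sums 1 make this
    selection injective. *)
Lemma asm_no_neg_perm K : is_asm K -> (forall x, ~~ is_neg K x) ->
  exists s, int_mx K = perm_mx s.
Proof.
move=> /and4P[/forallP hr /forallP hc _ _] nK.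
have K0 i j : 0 <= int_mx K i j.
  have := nK (i, j); rewrite /is_neg /=; have := int_mx_entry K i j.
  by rewrite !inE => /or3P[] /eqP ->.
pose g i := odflt i [pick j | int_mx K i j == 1].
have gP i : int_mx K i (g i) = 1.
  rewrite /g; case: pickP => [j /eqP //|none].
  suff /eqP : \sum_j int_mx K i j <= 0 by rewrite (eqP (hr i)).
  apply: sumr_le0 => j _; case: (int_mx_one_or_le0 K (i, j)) => //=.
  by rewrite /is_one /= none.
have g_inj : injective g.
  move=> i i' e; apply: (nonneg_sum1_uniq (fun k => K0 k (g i)) (eqP (hc (g i)))) => //.
  by rewrite e.
exists (perm g_inj); apply/matrixP => i j; rewrite [RHS]mxE [RHS]mxE permE.
have [<-|ne] /= := eqVneq (g i) j; first exact: gP.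
case: (int_mx_one_or_le0 K (i, j)) => /= [/eqP e|]; last first.
  by have := K0 i j; rewrite /=; lia.
by case/eqP: ne; apply: (nonneg_sum1_uniq (K0 i) (eqP (hr i))).
Qed.

Lemma perm_rsum K s i c : int_mx K = perm_mx s -> rsum K i c = (s i < c)%N%:Z.
Proof.
move=> eK; rewrite /rsum eK /psum.
under eq_bigr => j _ do rewrite !mxE.
case: (ltnP (s i) c) => cs.
  rewrite (bigD1 (s i)) //= eqxx big1 ?addr0 // => j /andP[_ ne].
  by rewrite eq_sym (negbTE ne).
rewrite big1 // => j jc; case: eqP => // e; move: cs; rewrite e; lia.
Qed.

Lemma perm_corner K s r c : int_mx K = perm_mx s ->
  corner K r c = #|[set i : 'I_n | (r <= i)%N & (s i < c)%N]|%:Z.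
Proof.
move=> eK; rewrite /corner.
under eq_bigr => i _ do rewrite (perm_rsum _ _ eK).
rewrite -sum1_card (big_morph Posz PoszD (erefl _)) big_mkcond [RHS]big_mkcond.
by apply: eq_bigr => i _; rewrite inE; case: (r <= i)%N; case: (s i < c)%N.
Qed.

(** Both directions of each comparison are kept because containment compares ordered pairs of
    indices. *)
Lemma contains_pattern3P s (w0 w1 w2 : nat) : reflect
  (exists a b c : 'I_n, [/\ (a < b < c)%N,
    (s a < s b)%N = (w0 < w1)%N /\ (s b < s a)%N = (w1 < w0)%N,
    (s a < s c)%N = (w0 < w2)%N /\ (s c < s a)%N = (w2 < w0)%N
    & (s b < s c)%N = (w1 < w2)%N /\ (s c < s b)%N = (w2 < w1)%N])
  (contains_pattern s [:: w0; w1; w2]).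
Proof.
apply: (iffP existsP) => [[f /andP[/forallP inc /forallP cmp]]|].
  pose o0 : 'I_3 := @Ordinal 3 0 isT; pose o1 : 'I_3 := @Ordinal 3 1 isT.
  pose o2 : 'I_3 := @Ordinal 3 2 isT.
  have I x y := forallP (inc x) y; have C x y := eqP (forallP (cmp x) y).
  exists (f o0), (f o1), (f o2); split.
  - by have /= -> := I o0 o1; have /= -> := I o1 o2.
  - by rewrite (C o0 o1) (C o1 o0).
  - by rewrite (C o0 o2) (C o2 o0).
  - by rewrite (C o1 o2) (C o2 o1).
case=> a [b [c [/andP[ab bc] [c1 c2] [c3 c4] [c5 c6]]]].
have ac := ltn_trans ab bc.
exists [ffun k : 'I_3 => nth a [:: a; b; c] k]; apply/andP; split.
  apply/forallP => -[[|[|[|//]]] ?]; apply/forallP => -[[|[|[|//]]] ?];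
    by rewrite !ffunE //=.
apply/forallP => -[[|[|[|//]]] ?]; apply/forallP => -[[|[|[|//]]] ?];
  by rewrite !ffunE //= ?ltnn ?c1 ?c2 ?c3 ?c4 ?c5 ?c6.
Qed.

(** Two rows from [r] on with values below [c], preceded by a row with value at least [c], form a
    312 or a 321. *)
Lemma avoids_low K s : is_asm K -> int_mx K = perm_mx s ->
  avoids s [:: 3; 1; 2]%N -> avoids s [:: 3; 2; 1]%N -> low K.
Proof.
move=> asmK eK /contains_pattern3P av1 /contains_pattern3P av2 r c rc.
rewrite leNgt; apply/negP => gt1.
have rn : (r < n)%N.
  by rewrite ltnNge; apply/negP => nr; move: gt1; rewrite corner_bottom.
have [a ar ca] : exists2 a : 'I_n, (a < r)%N & (c <= s a)%N.
  case: (pickP (fun a : 'I_n => (a < r)%N && (c <= s a)%N)) => [a /andP[]|none].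
    by exists a.
  have cn : (c <= n)%N by lia.
  (* If every row above [r] has its value below [c], each such row lowers the corner sum by exactly
     1, leaving [c - r <= 1]. *)
  suff e k : (k <= r)%N -> corner K k c = c%:Z - k%:Z.
    by have := e r (leqnn r); lia.
  elim: k => [|k IH] kr; first by rewrite asm_corner_top ?subr0.
  have kn : (k < n)%N by lia.
  have := corner_row K (Ordinal kn) c; rewrite (perm_rsum _ _ eK) /= IH; last lia.
  have := none (Ordinal kn); rewrite /= kr /=; lia.
move: gt1; rewrite (perm_corner _ _ eK) ltz_nat => /card_gt1P[x [y []]].
rewrite !inE => /andP[rx sx] /andP[ry sy] xy.
wlog lt : x y rx sx ry sy xy / (x < y)%N.
  move=> H; case: (ltngtP x y) => cmp; [exact: (H x y) | | ].
    by apply: (H y x) => //; rewrite eq_sym.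
  by case/eqP: xy; apply: ord_inj.
case: (ltngtP (s x) (s y)) => cmp.
- by apply: av1; exists a, x, y; split; lia.
- by apply: av2; exists a, x, y; split; lia.
by case/eqP: xy; apply: (@perm_inj _ s); apply: ord_inj.
Qed.

(** By [low_corner], rows [a] and [a.+1] differ by 1 at column [a.+2], so [s a <= a.+1]. The bound
    then applies at row [a.+1] and column [s a], where both [b] and [c] are counted. *)
Lemma low_no_two_below K s (a b c : 'I_n) : is_asm K -> int_mx K = perm_mx s ->
  low K -> (a < b < c)%N -> (s b < s a)%N -> (s c < s a)%N -> False.
Proof.
move=> asmK eK lowK /andP[ab bc] ba ca.
have sa : (s a < a.+2)%N.
  case: (leqP a.+2 n) => an; last by have := ltn_ord (s a); lia.
  have := corner_row K a a.+2; rewrite !(low_corner asmK lowK) //; try lia.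
  by rewrite (perm_rsum _ _ eK); lia.
have := lowK a.+1 (s a) (ltnW sa); rewrite (perm_corner _ _ eK) lez_nat leqNgt.
case/negP; apply/card_gt1P; exists b, c.
rewrite !inE; split; rewrite ?ba ?ca ?ab ?andbT //; first by rewrite (ltn_trans ab).
by apply: contraTneq bc => ->; rewrite ltnn.
Qed.

Lemma low_avoids K s : is_asm K -> int_mx K = perm_mx s -> low K ->
  avoids s [:: 3; 1; 2]%N && avoids s [:: 3; 2; 1]%N.
Proof.
move=> asmK eK lowK; apply/andP; split; apply/negP => /contains_pattern3P;
  move=> [a [b [c [abc [_ /= ba] [_ /= ca] _]]]];
  exact: (low_no_two_below asmK eK lowK abc).
Qed.

(** An avoiding key is [low] and its corner sums dominate those of [A]; conversely [low] survives up
    to the key built by [exists_final]. *)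
Lemma key_avoids_low A : is_asm A ->
  [exists s : 'S_n,
     [&& is_sw_key A s, avoids s [:: 3; 1; 2]%N & avoids s [:: 3; 2; 1]%N]]
  <-> low A.
Proof.
move=> asmA; split=> [/existsP[s /and3P[/existsP[K /andP[cAK /eqP eK]] a1 a2]]|lowA].
  have [asmK le] := connect_sw_step asmA cAK.
  move=> r c rc; apply: le_trans (le r c) _; exact: avoids_low eK a1 a2 _ _ rc.
have [K [cAK asmK nK lowK]] := exists_final asmA.
have [s eK] := asm_no_neg_perm asmK nK.
apply/existsP; exists s; apply/andP; split; last exact: low_avoids eK (lowK lowA).
by apply/existsP; exists K; rewrite cAK eK eqxx.
Qed.

End Key.

(** * Counting *)

(* Weakly increasing sequences t_0, ..., t_{n-1} with t_r <= min(r, k). *)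
Fixpoint ballot_seqs n k : seq (seq nat) :=
  if n is m.+1 then
    [seq rcons s t | t <- iota 0 (minn k m).+1, s <- ballot_seqs m t]
  else [:: [::]].

Lemma ballot_seqsS n k : ballot_seqs n.+1 k =
  [seq rcons s t | t <- iota 0 (minn k n).+1, s <- ballot_seqs n t].
Proof. by []. Qed.

Lemma ballot_seqsP n k s : reflect
  [/\ size s = n, forall r, r < n -> nth 0 s r <= minn r k
    & forall r, r.+1 < n -> nth 0 s r <= nth 0 s r.+1]
  (s \in ballot_seqs n k).
Proof.
elim: n k s => [|n IH] k s.
  rewrite inE; apply: (iffP eqP) => [->|[/size0nil]//]; by split.
rewrite ballot_seqsS; apply: (iffP (allpairsPdep (T := fun _ => seq nat))).
  move=> [t [s' [+ /IH[sz le inc] ->]]].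
  rewrite mem_iota add0n /= ltnS => tk; split; first by rewrite size_rcons sz.
    move=> r; rewrite ltnS => rn; rewrite nth_rcons sz.
    case: (ltngtP r n) rn => // [lt|->] _; last by rewrite leq_min -leq_min minnC.
    by have := le r lt; lia.
  move=> r; rewrite ltnS => rn; rewrite !nth_rcons sz rn.
  by have := le r rn; have := inc r; case: ltngtP; lia.
case/lastP: s => [|s t] [sz le inc]; first by [].
move: sz; rewrite size_rcons => -[sz]; exists t, s.
have tk := le n (ltnSn n); rewrite nth_rcons sz ltnn eqxx in tk.
split=> //; first by rewrite mem_iota; lia.
have nthE r : r < n -> nth 0 (rcons s t) r = nth 0 s r.
  by move=> rn; rewrite nth_rcons sz rn.
apply/IH; split=> // r rn.
  (* Monotonicity bounds every entry by the last one [t], which is the cap for the shorter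
     sequence. *)
  have chain j : r <= j <= n -> nth 0 (rcons s t) r <= nth 0 (rcons s t) j.
    elim: j => [|j IHj] rj; first by rewrite (_ : r = 0) //; lia.
    case: (ltnP j r) => jr; first by rewrite (_ : r = j.+1) //; lia.
    by apply: leq_trans (IHj ltac:(lia)) (inc j ltac:(lia)).
  have := chain n ltac:(lia); have := le r ltac:(lia).
  by rewrite nthE // nth_rcons sz ltnn eqxx; lia.
by have := inc r (ltnW rn); rewrite !nthE //; lia.
Qed.

Lemma ballot_seqs_uniq n k : uniq (ballot_seqs n k).
Proof.
elim: n k => [//|n IH] k.
rewrite ballot_seqsS; apply: (allpairs_uniq_dep (T := fun _ => seq nat)) => //.
- exact: iota_uniq.
by move=> [x s] [y t] _ _ /= /rcons_inj[-> ->].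
Qed.

Lemma size_ballot_seqsS n k :
  size (ballot_seqs n.+1 k) = \sum_(0 <= t < (minn k n).+1) size (ballot_seqs n t).
Proof. by rewrite ballot_seqsS size_allpairs_dep sumnE big_map. Qed.

Lemma size_ballot_seqs0 n : size (ballot_seqs n 0) = 1.
Proof. by elim: n => // n IH; rewrite size_ballot_seqsS min0n big_nat1. Qed.

(** The ballot formula, stated additively to avoid truncated subtraction. Splitting off the largest
    last entry gives a Pascal-type recurrence in [n] and [k]; at [k = n] the cap stops mattering. *)
Lemma size_ballot_seqs n k : k <= n ->
  size (ballot_seqs n k) + (if k is j.+1 then 'C(n + k, j) else 0) = 'C(n + k, k).
Proof.
elim: n k => [|n IHn]; first by case.
elim=> [|k IHk] kn; first by rewrite size_ballot_seqs0 bin0.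
have {}IHk := IHk (ltnW kn).
have binsum : 'C(n.+1 + k.+1, k) = 'C(n.+1 + k, k)
    + (if k is j.+1 then 'C(n.+1 + k, j) else 0).
  by case: (k) => [|j]; rewrite ?bin0 // addnS binS.
rewrite binsum [in RHS]addnS binS; case: (ltnP k n) => kn'.
  have := IHn k.+1 kn'.
  rewrite [size (ballot_seqs n.+1 k.+1)]size_ballot_seqsS.
  rewrite (minn_idPl kn') big_nat_recr //= -[in \sum_(_ <= _ < _) _](minn_idPl (ltnW kn')).
  rewrite -size_ballot_seqsS.
  by rewrite -addSnnS; lia.
have {kn kn'} e : k = n by lia.
subst k; have -> : size (ballot_seqs n.+1 n.+1) = size (ballot_seqs n.+1 n).
  by rewrite !size_ballot_seqsS minnn (minn_idPr (leqnSn n)).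
have -> : 'C(n.+1 + n, n.+1) = 'C(n.+1 + n, n).
  by rewrite -[RHS]bin_sub ?leq_addl // addnK.
lia.
Qed.

Lemma size_ballot_seqs_catalan n : size (ballot_seqs n n) = catalan n.
Proof.
case: n => [//|n]; have := size_ballot_seqs (leqnn n.+1).
have := mul_bin_left (n.+1 + n.+1) n; rewrite /catalan mul2n -addnn.
have -> : n.+1 + n.+1 - n = n.+2 by lia.
set x := 'C(_, n.+1); set y := 'C(_, n); set z := size _ => e1 e2.
(* Here [n.+1 * x = n.+2 * y] and [z + y = x]. *)
have -> : x = n.+2 * z by nia.
by rewrite mulKn.
Qed.

(** * Bijection between low matrices and ballot sequences *)

Section Count.
Local Open Scope ring_scope.
Variable n : nat.
Implicit Types (A : 'M[entry]_n) (s : seq nat).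

(* The default value [r] of [nth] makes row [n] vanish for columns up to [n]. *)
Definition height s (r c : nat) : nat := maxn (nth r s r < c)%N (c - r).

(** The entry that [corner_entry] forces if the corner sums are to be [height s]. *)
Definition height_diff s (r c : nat) : int :=
  (height s r c.+1)%:Z - (height s r.+1 c.+1)%:Z - (height s r c)%:Z
  + (height s r.+1 c)%:Z.

(** For ballot sequences the default [entry0] is never reached, see [height_mx_entry]. *)
Definition height_mx s : 'M[entry]_n :=
  \matrix_(r, c) insubd entry0 (height_diff s r c).

(** Telescoping along each row from the left edge, then over the rows from the bottom edge. *)
Lemma corner_unique A (H : nat -> nat -> int) :
  (forall r c : 'I_n,
     int_mx A r c = H r c.+1 - H r.+1 c.+1 - H r c + H r.+1 c) ->
  (forall r, (r <= n)%N -> H r 0%N = 0) -> (forall c, (c <= n)%N -> H n c = 0) ->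
  forall r c, (r <= n)%N -> (c <= n)%N -> corner A r c = H r c.
Proof.
move=> eA H0 Hn.
have eR (r : 'I_n) c : (c <= n)%N -> rsum A r c = H r c - H r.+1 c.
  elim: c => [|c IH] cn; first by rewrite /rsum psum0 !H0 ?subrr // ltnW.
  by rewrite (rsumS A r (Ordinal cn)) IH ?eA /=; lia.
move=> r c rn cn; have [k] := ubnP (n - r)%N; elim: k r rn => // k IH r rn rk.
case: (ltnP r n) => [rn'|nr]; last first.
  by rewrite corner_bottom // (_ : r = n) ?Hn //; lia.
have := corner_row A (Ordinal rn') c; rewrite eR //= (IH r.+1) //; lia.
Qed.

Section HeightMatrix.
Variables (s : seq nat) (ballot_s : s \in ballot_seqs n n).

Lemma ballot_le r : (nth r s r <= r)%N.
Proof.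
case/ballot_seqsP: ballot_s => sz le _; case: (ltnP r n) => rn.
  by rewrite (set_nth_default 0%N) ?sz //; have := le r rn; lia.
by rewrite nth_default ?sz.
Qed.

Lemma ballot_mono r : (nth r s r <= nth r.+1 s r.+1)%N.
Proof.
case/ballot_seqsP: ballot_s => sz _ inc; case: (ltnP r.+1 n) => rn.
  rewrite (set_nth_default 0%N) ?sz ?(ltnW rn) //.
  by rewrite [leqRHS](set_nth_default 0%N) ?sz // inc.
by rewrite [leqRHS]nth_default ?sz // (leq_trans (ballot_le r)).
Qed.

(** Steps of 0 or 1 here and in [height_col] become the bounds on prefix and suffix sums in
    [asmP]. *)
Lemma height_row r c :
  (height s r.+1 c <= height s r c <= (height s r.+1 c).+1)%N.
Proof. rewrite /height; have := ballot_le r; have := ballot_mono r; lia. Qed.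

Lemma height_col r c : (height s r c <= height s r c.+1 <= (height s r c).+1)%N.
Proof. rewrite /height; have := ballot_le r; lia. Qed.

Lemma height_left r : height s r 0 = 0%N. Proof. by []. Qed.

Lemma height_bottom r c : (n <= r)%N -> (c <= n)%N -> height s r c = 0%N.
Proof.
case/ballot_seqsP: ballot_s => sz _ _ nr cn.
rewrite /height nth_default ?sz //; lia.
Qed.

Lemma height_top c : height s 0 c = c.
Proof. rewrite /height; have := ballot_le 0; lia. Qed.

Lemma height_above r c : (r < c)%N -> height s r c = (c - r)%N.
Proof. rewrite /height; lia. Qed.

(** The entry is a difference of two steps in {0, 1}. *)
Lemma height_mx_entry (r c : 'I_n) : int_mx (height_mx s) r c = height_diff s r c.
Proof.
rewrite !mxE val_insubd; case: ifP => // /negP[]; rewrite !inE /height_diff.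
have := height_row r c; have := height_row r c.+1.
have := height_col r c; have := height_col r.+1 c; lia.
Qed.

Lemma height_mx_corner r c : (r <= n)%N -> (c <= n)%N ->
  corner (height_mx s) r c = (height s r c)%:Z.
Proof.
apply: (@corner_unique _ (fun r c => (height s r c)%:Z)) => [i j|i _|j jn].
- exact: height_mx_entry.
- by rewrite height_left.
by rewrite height_bottom.
Qed.

Lemma height_mx_asm : is_asm (height_mx s).
Proof.
have eR (r : 'I_n) c : (c <= n)%N ->
    rsum (height_mx s) r c = (height s r c)%:Z - (height s r.+1 c)%:Z.
  move=> cn; have := corner_row (height_mx s) r c.
  by rewrite !height_mx_corner //; [lia | exact: ltnW].
have eC r (c : 'I_n) : (r <= n)%N ->
    csum (height_mx s) r c = (height s r c.+1)%:Z - (height s r c)%:Z.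
  move=> rn; have := corner_col (height_mx s) r c.
  by rewrite !height_mx_corner //; [lia | exact: ltnW].
apply/asmP; split=> [r c|r c|r|c].
- case: (leqP c n) => cn; first by rewrite eR //; have := height_row r c; lia.
  have -> : rsum (height_mx s) r c = rsum (height_mx s) r n.
    by rewrite /rsum (psum_total _ (ltnW cn)) psum_total.
  by rewrite eR //; have := height_row r n; lia.
- case: (leqP r n) => rn; first by rewrite eC //; have := height_col r c; lia.
  by rewrite /csum ssum_out // ltnW.
- rewrite eR //; have rn := ltn_ord r; rewrite height_above //.
  (* The last row is separate because [height_above] would need [r.+1 < n]. *)
  have [e|ne] := eqVneq r.+1 n; first by rewrite height_bottom ?e //; lia.
  by rewrite height_above; lia.
by rewrite eC // !height_top; lia.
Qed.

Lemma height_mx_low : low (height_mx s).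
Proof.
move=> r c rc; case: (ltnP r n) => rn; last by rewrite corner_bottom.
by rewrite height_mx_corner ?(ltnW rn) /height //; lia.
Qed.

End HeightMatrix.

Lemma height_mx_inj : {in ballot_seqs n n &, injective height_mx}.
Proof.
move=> s t Bs Bt e.
case/ballot_seqsP: (Bs) => szs _ _; case/ballot_seqsP: (Bt) => szt _ _.
apply: (@eq_from_nth _ 0%N); rewrite szs // => r rn.
rewrite (set_nth_default r) ?szs // [RHS](set_nth_default r) ?szt //.
have eH c : (c <= r.+1)%N -> height s r c = height t r c.
  move=> cr; have cn := leq_trans cr rn.
  by apply/eqP; rewrite -eqz_nat -!height_mx_corner ?e // ltnW.
have := ballot_le Bs r; have := ballot_le Bt r.
(* Just past its threshold a row has height 1; comparing both arrays there bounds each threshold by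
   the other. *)
have := eH (nth r s r).+1; have := eH (nth r t r).+1; rewrite /height; lia.
Qed.

(** When no column qualifies, [find] returns [r], in agreement with the value 1 that [low_corner]
    forces at column [r.+1]. *)
Definition threshold A r : nat :=
  find (fun c => 0 < corner A r c.+1) (iota 0 r).

Section Low.
Variables (A : 'M[entry]_n) (asmA : is_asm A) (lowA : low A).

Lemma threshold_le r : (threshold A r <= r)%N.
Proof. by rewrite -[leqRHS](size_iota 0 r) find_size. Qed.

(** Up to column [r.+1] the corner sums of row [r] are 0 or 1 and increase with [c], so they form a
    single step. *)
Lemma threshold_corner r c : (r < n)%N -> (c <= r.+1)%N ->
  corner A r c = (threshold A r < c)%N%:Z.
Proof.
move=> rn cr; have := lowA cr; have cn := leq_trans cr rn.
have ge0 : 0 <= corner A r c.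
  by rewrite -(corner_left A r); apply: asm_corner_anti.
case: (ltnP (threshold A r) c) => tc.
  suff : 0 < corner A r (threshold A r).+1.
    by have := @asm_corner_anti _ A r r c (threshold A r).+1 asmA (leqnn r) tc cn; lia.
  have := threshold_le r; rewrite leq_eqVlt => /orP[/eqP->|tr].
    by rewrite low_corner //; lia.
  have : has (fun c => 0 < corner A r c.+1) (iota 0 r) by rewrite has_find size_iota.
  by move/(nth_find 0%N); rewrite nth_iota.
case: c tc cr cn ge0 => [|c] tc cr cn ge0; first by rewrite corner_left.
have := before_find 0%N tc; rewrite nth_iota; last by have := threshold_le r; lia.
by rewrite add0n; lia.
Qed.

Lemma low_height_mx : exists2 s, s \in ballot_seqs n n & A = height_mx s.
Proof.
pose s := mkseq (threshold A) n.
have nthE d r : (r < n)%N -> nth d s r = threshold A r by apply: nth_mkseq.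
have Bs : s \in ballot_seqs n n.
  apply/ballot_seqsP; split=> [|r rn|r rn]; first by rewrite size_mkseq.
    by rewrite nthE //; have := threshold_le r; lia.
  (* Corner sums decrease with the row, so a step reached in row [r.+1] is already reached in row
     [r]; a threshold [r.+1] exceeds [r] anyway. *)
  have rn' := ltnW rn; rewrite !nthE //; case: (ltnP (threshold A r.+1) r.+1) => tr.
    have := @asm_corner_anti _ A r r.+1 (threshold A r.+1).+1 _ asmA (leqnSn r) (leqnn _).
    by rewrite !threshold_corner //; lia.
  by have := threshold_le r; lia.
exists s => //; apply: int_mx_inj; apply/matrixP => r c.
have eH i j : (i <= n)%N -> (j <= n)%N -> corner A i j = corner (height_mx s) i j.
  move=> ile jle; rewrite height_mx_corner //; case: (ltnP i n) => ilt; last first.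
    by rewrite corner_bottom // height_bottom.
  case: (leqP j i.+1) => ij; last first.
    by rewrite (low_corner asmA lowA (ltnW ij)) // height_above; lia.
  by rewrite threshold_corner // /height nthE //; have := threshold_le i; lia.
by rewrite !corner_entry !eH // ltnW.
Qed.

End Low.
End Count.

Theorem theorem4p8 (n : nat) (hn : 1 <= n) :
  #|[set A : 'M[entry]_n
      | is_asm A
      & [exists s : 'S_n,
          [&& is_sw_key A s, avoids s [:: 3; 1; 2] & avoids s [:: 3; 2; 1]]]]|
  = catalan n.
Proof.
(* The matrices counted are exactly the values of [height_mx] on ballot sequences, without
   repetition. *)
rewrite -size_ballot_seqs_catalan -(size_map (@height_mx n)).
rewrite -(card_uniqP _); last first.
  by rewrite map_inj_in_uniq ?ballot_seqs_uniq //; apply: height_mx_inj.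
apply: eq_card => A; rewrite inE; apply/andP/mapP.
  case=> asmA /(key_avoids_low asmA) lowA.
  by have [s Bs ->] := low_height_mx asmA lowA; exists s.
case=> s Bs ->; have asmA := height_mx_asm Bs; split=> //.
by apply/(key_avoids_low asmA); apply: height_mx_low.
Qed.
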